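(* For any $k\ge 3$, Minimum-$k$-Attractor can be approximated in polynomial time up to a factor of $\mathcal{H}(k(k+1)/2)$, where $\mathcal{H}(p)=\sum_{i=1}^{p}\frac{1}{i}$ is the $p$-th harmonic number. In particular, the problem of finding a smallest string attractor of a string of length $n$ can be approximated in polynomial time to a factor $\mathcal{H}(n(n+1)/2)\le 2\ln((n+1)/\sqrt2)+1$.
   Context: For a string $T$ of length $n$ and a positive integer $k$, a set $\Gamma\subseteq\{1,\dots,n\}$ is a $k$-attractor of $T$ if every substring $T[i..j]$ with $i\le j<i+k$ has an occurrence $T[i'..j']=T[i..j]$ with $p\in[i',j']$ for some $p\in\Gamma$. Minimum-$k$-Attractor asks, given $T$, for a $k$-attractor of minimum size. A string attractor is an $n$-attractor (captures all substrings). *)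

(* Defs.v *)
From mathcomp Require Import all_boot all_order all_algebra.

Set Implicit Arguments.
Unset Strict Implicit.
Unset Printing Implicit Defensive.

(** * String attractors

    The position p in {1, ..., n} of a string of length n is represented by the
    ordinal p - 1 : 'I_n; substr T i j is T[i..j], both ends included. *)

Definition substr (A : Type) (T : seq A) (i j : nat) : seq A :=
  take (j.+1 - i) (drop i T).

Definition attractor (A : eqType) (k : nat) (T : seq A)
    (G : {set 'I_(size T)}) : bool :=
  [forall i : 'I_(size T), forall j : 'I_(size T), (i <= j < i + k) ==>
    [exists i' : 'I_(size T), exists j' : 'I_(size T),
      (substr T i' j' == substr T i j) &&
      [exists p : 'I_(size T), (p \in G) && (i' <= p <= j')]]].

Definition string_attractor (A : eqType) (T : seq A)
    (G : {set 'I_(size T)}) : bool :=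
  attractor (size T) G.

(** * Random access machines

    Unit-cost RAM over the natural numbers with addition and truncated
    subtraction, in structured form. There are infinitely many registers and
    memory cells, but an instruction names its registers by constants, so a
    program uses finitely many registers; the memory is reached only by
    indirect addressing. As there is no multiplication, the bit length of the
    largest value grows by at most one per step (after the constants of the
    program), so that polynomial time on this machine agrees with polynomial
    time on Turing machines. *)

Inductive ram_prog : Type :=
  | Nop
  | Const of nat & nat
  | Add of nat & nat & nat
  | Sub of nat & nat & nat
  | Read of nat & nat
  | Write of nat & nat
  | Seq of ram_prog & ram_prog
  | If of nat & ram_prog & ram_prog
  | While of nat & ram_prog.

Record ram_state : Type := RamState { reg : nat -> nat; mem : nat -> nat }.

Definition update (f : nat -> nat) (a v : nat) : nat -> nat :=
  fun x => if x == a then v else f x.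

Definition set_reg (s : ram_state) (r v : nat) : ram_state :=
  RamState (update (reg s) r v) (mem s).

Definition set_mem (s : ram_state) (a v : nat) : ram_state :=
  RamState (reg s) (update (mem s) a v).

(** [exec P s t s']: started in state s, the program P halts in state s' after
    exactly t steps; every elementary instruction and every test of an [If] or
    of a [While] is one step. *)
Inductive exec : ram_prog -> ram_state -> nat -> ram_state -> Prop :=
  | exec_Nop s : exec Nop s 1 s
  | exec_Const s r c : exec (Const r c) s 1 (set_reg s r c)
  | exec_Add s r a b : exec (Add r a b) s 1 (set_reg s r (reg s a + reg s b))
  | exec_Sub s r a b : exec (Sub r a b) s 1 (set_reg s r (reg s a - reg s b))
  | exec_Read s r a : exec (Read r a) s 1 (set_reg s r (mem s (reg s a)))
  | exec_Write s a b : exec (Write a b) s 1 (set_mem s (reg s a) (reg s b))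
  | exec_Seq s1 s2 s3 t u P Q :
      exec P s1 t s2 -> exec Q s2 u s3 -> exec (Seq P Q) s1 (t + u) s3
  | exec_If_nz s s' t r P Q :
      reg s r <> 0 -> exec P s t s' -> exec (If r P Q) s t.+1 s'
  | exec_If_z s s' t r P Q :
      reg s r = 0 -> exec Q s t s' -> exec (If r P Q) s t.+1 s'
  | exec_While_z s r P : reg s r = 0 -> exec (While r P) s 1 s
  | exec_While_nz s1 s2 s3 t u r P :
      reg s1 r <> 0 -> exec P s1 t s2 -> exec (While r P) s2 u s3 ->
      exec (While r P) s1 (t + u).+1 s3.

Lemma exec_deterministic P s t1 s1 t2 s2 :
  exec P s t1 s1 -> exec P s t2 s2 -> t1 = t2 /\ s1 = s2.
Proof.
move=> H1; elim: H1 t2 s2 => {P s t1 s1}.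
1-6: by intros; match goal with H : exec _ _ _ _ |- _ => inversion H end.
- move=> s1 s2 s3 t u P Q _ IHP _ IHQ t2 s' H; inversion H; subst.
  by have [-> e] := IHP _ _ H2; subst; have [-> ->] := IHQ _ _ H6.
- move=> s s' t r P Q nz _ IH t2 s2 H; inversion H; subst => //.
  by have [-> ->] := IH _ _ H7.
- move=> s s' t r P Q nz _ IH t2 s2 H; inversion H; subst => //.
  by have [-> ->] := IH _ _ H7.
- by move=> s r P z t2 s2 H; inversion H; subst.
- move=> s1 s2 s3 t u r P nz _ IHP _ IHW t2 s' H; inversion H; subst => //.
  by have [-> e] := IHP _ _ H3; subst; have [-> ->] := IHW _ _ H7.
Qed.

(** The input string is a word over the alphabet of all natural numbers, one
    letter per memory cell, with its length in register 0. A finite sequence is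
    output in the same format. *)
Definition ram_input (T : seq nat) : ram_state :=
  RamState (update (fun=> 0) 0 (size T)) (nth 0 T).

Definition ram_output (s : ram_state) : seq nat := mkseq (mem s) (reg s 0).

(** * Approximation

    A family [feasible] is a minimization problem: given T, find a set of
    positions satisfying [feasible T] of minimum size. *)

Definition minimum (X : finType) (F : {set X} -> bool) (G : {set X}) : Prop :=
  F G /\ forall G' : {set X}, F G' -> #|G| <= #|G'|.

(** The program prints the elements of its solution G in any order, without
    repetition; the ratio [rho] may depend on the length of the input. *)
Definition poly_time_approx (R : numDomainType)
    (feasible : forall T : seq nat, {set 'I_(size T)} -> bool)
    (rho : nat -> R) : Prop :=
  exists (P : ram_prog) (c d : nat), forall T : seq nat,
  exists (t : nat) (s : ram_state) (G : {set 'I_(size T)}),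
    [/\ exec P (ram_input T) t s,
        t <= c * size T ^ d + c,
        perm_eq (ram_output s) [seq val p | p <- enum G],
        feasible T G
      & forall Gmin : {set 'I_(size T)}, minimum (feasible T) Gmin ->
          (#|G|%:R <= rho (size T) * #|Gmin|%:R)%R ].

Definition harmonic_number (R : fieldType) (p : nat) : R :=
  (\sum_(1 <= i < p.+1) i%:R^-1)%R.

(* Main.v *)
(** A position p of the string T is identified with the set of distinct substrings
    of length at most k that have an occurrence through p; an attractor is then a
    set cover. An occurrence [i..j] through p is determined by (p - i, j - i), so
    each of these sets has at most k(k+1)/2 elements, and the greedy set cover has
    ratio H(k(k+1)/2): for a fixed cover C, the potential
      sum over q in C of H(|S q|) - H(number of uncovered elements of S q)
    starts at 0, grows by at least 1 with each greedy choice, and never exceeds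
    |C| H(max |S q|).

    For the running time, the greedy algorithm is written with loops of length n
    only, without any test: Boolean conditions are 0/1-valued expressions built
    from sums and truncated differences. The cost of such a program is then a
    polynomial in n that does not depend on the contents of the memory. *)

Require Import Defs.
From mathcomp Require Import all_boot all_order all_algebra.
From mathcomp Require Import reals exp.
From mathcomp Require Import zify ring lra.
Import Defs.

Set Implicit Arguments.
Unset Strict Implicit.
Unset Printing Implicit Defensive.

(** * Bounded-loop programs and their compilation *)

(** [Sum] is the only binder. With the truncated [Minus] it yields Boolean connectives, bounded
    quantifiers and counting. *)
Inductive expr : Type :=
  | Size
  | Lit of nat
  | Var of nat
  | Fetch of expr
  | Plus of expr & expr
  | Minus of expr & expr
  | Sum of nat & expr.

Inductive cmd : Type :=
  | Store of expr & expr
  | Then of cmd & cmd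
  | For of nat & cmd.

Fixpoint eval (n : nat) (m rho : nat -> nat) (e : expr) : nat :=
  match e with
  | Size => n
  | Lit c => c
  | Var x => rho x
  | Fetch e => m (eval n m rho e)
  | Plus e1 e2 => eval n m rho e1 + eval n m rho e2
  | Minus e1 e2 => eval n m rho e1 - eval n m rho e2
  | Sum x e => \sum_(i < n) eval n m (update rho x i) e
  end.

Fixpoint run (n : nat) (rho : nat -> nat) (c : cmd) (m : nat -> nat) :
    nat -> nat :=
  match c with
  | Store a e => update m (eval n m rho a) (eval n m rho e)
  | Then c1 c2 => run n rho c2 (run n rho c1 m)
  | For x c => iteri n (fun i => run n (update rho x i) c) m
  end.

(* Register 0 holds the length of the input, the odd registers hold the
   variables and the remaining even registers are temporaries. *)
Definition var_reg (x : nat) : nat := x.*2.+1.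
Definition tmp_reg (d : nat) : nat := d.*2.+2.

(** [tmp_reg d] saves the old value of the loop variable and [tmp_reg d.+1] counts the remaining
    rounds. A register is copied by adding it to a zeroed one. *)
Definition for_prog (x d : nat) (P : ram_prog) : ram_prog :=
  Seq (Const (tmp_reg d) 0)
  (Seq (Add (tmp_reg d) (tmp_reg d) (var_reg x))
  (Seq (Const (var_reg x) 0)
  (Seq (Sub (tmp_reg d.+1) 0 (var_reg x))
  (Seq (While (tmp_reg d.+1)
         (Seq P
         (Seq (Const (tmp_reg d.+1) 1)
         (Seq (Add (var_reg x) (var_reg x) (tmp_reg d.+1))
              (Sub (tmp_reg d.+1) 0 (var_reg x))))))
  (Seq (Const (var_reg x) 0)
       (Add (var_reg x) (var_reg x) (tmp_reg d))))))).

(** The temporaries form a stack: the value is left in [tmp_reg d], and those below level [d] are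
    untouched. *)
Fixpoint compile_expr (d : nat) (e : expr) : ram_prog :=
  match e with
  | Size => Seq (Const (tmp_reg d) 0) (Add (tmp_reg d) (tmp_reg d) 0)
  | Lit c => Const (tmp_reg d) c
  | Var x => Seq (Const (tmp_reg d) 0) (Add (tmp_reg d) (tmp_reg d) (var_reg x))
  | Fetch e => Seq (compile_expr d e) (Read (tmp_reg d) (tmp_reg d))
  | Plus e1 e2 => Seq (compile_expr d e1) (Seq (compile_expr d.+1 e2)
      (Add (tmp_reg d) (tmp_reg d) (tmp_reg d.+1)))
  | Minus e1 e2 => Seq (compile_expr d e1) (Seq (compile_expr d.+1 e2)
      (Sub (tmp_reg d) (tmp_reg d) (tmp_reg d.+1)))
  | Sum x e => Seq (Const (tmp_reg d) 0) (for_prog x d.+1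
      (Seq (compile_expr d.+3 e)
           (Add (tmp_reg d) (tmp_reg d) (tmp_reg d.+3))))
  end.

Fixpoint compile (d : nat) (c : cmd) : ram_prog :=
  match c with
  | Store a e => Seq (compile_expr d a) (Seq (compile_expr d.+1 e)
      (Write (tmp_reg d) (tmp_reg d.+1)))
  | Then c1 c2 => Seq (compile d c1) (compile d c2)
  | For x c => for_prog x d (compile d.+2 c)
  end.

(** Each round adds a test and three instructions to the body; the 7 counts four instructions of
    preparation, the last test and two of restoration. *)
Definition for_cost (n c : nat) : nat := n * (c + 4) + 7.

Fixpoint cost_expr (n : nat) (e : expr) : nat :=
  match e with
  | Size | Var _ => 2
  | Lit _ => 1
  | Fetch e => cost_expr n e + 1
  | Plus e1 e2 | Minus e1 e2 => cost_expr n e1 + (cost_expr n e2 + 1)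
  | Sum x e => 1 + for_cost n (cost_expr n e + 1)
  end.

Fixpoint cost (n : nat) (c : cmd) : nat :=
  match c with
  | Store a e => cost_expr n a + (cost_expr n e + 1)
  | Then c1 c2 => cost n c1 + cost n c2
  | For x c => for_cost n (cost n c)
  end.

(** * Correctness and exact cost of the compiled programs *)

Definition env_ok (n : nat) (rho : nat -> nat) (s : ram_state) : Prop :=
  reg s 0 = n /\ forall x, reg s (var_reg x) = rho x.

Definition keeps (d : nat) (s s' : ram_state) : Prop :=
  forall e, e < d -> reg s' (tmp_reg e) = reg s (tmp_reg e).

Lemma var_reg_eq x y : (var_reg x == var_reg y) = (x == y).
Proof. rewrite /var_reg; lia. Qed.

Lemma tmp_reg_eq d e : (tmp_reg d == tmp_reg e) = (d == e).
Proof. rewrite /tmp_reg; lia. Qed.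

Lemma var_tmp_reg x d : (var_reg x == tmp_reg d) = false.
Proof. rewrite /tmp_reg /var_reg; lia. Qed.

Lemma tmp_var_reg x d : (tmp_reg d == var_reg x) = false.
Proof. by rewrite eq_sym var_tmp_reg. Qed.

Lemma zero_var_reg x : (0 == var_reg x) = false. Proof. by []. Qed.

Lemma zero_tmp_reg d : (0 == tmp_reg d) = false. Proof. by []. Qed.

Definition reg_eqE := (var_reg_eq, tmp_reg_eq, var_tmp_reg, tmp_var_reg,
  zero_var_reg, zero_tmp_reg, eqxx).

Lemma keeps_trans d s1 s2 s3 : keeps d s1 s2 -> keeps d s2 s3 -> keeps d s1 s3.
Proof. by move=> h1 h2 e he; rewrite h2 // h1. Qed.

Lemma keepsW d d' s1 s2 : d <= d' -> keeps d' s1 s2 -> keeps d s1 s2.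
Proof. by move=> le h e he; apply: h; apply: leq_trans le. Qed.

Lemma keeps_tmp d d' s v : d <= d' -> keeps d s (set_reg s (tmp_reg d') v).
Proof.
by move=> le e he; rewrite /= /update reg_eqE ltn_eqF //; apply: leq_trans le.
Qed.

Lemma keeps_var d x s v : keeps d s (set_reg s (var_reg x) v).
Proof. by move=> e he; rewrite /= /update reg_eqE. Qed.

Lemma env_ok_tmp n rho s d v :
  env_ok n rho s -> env_ok n rho (set_reg s (tmp_reg d) v).
Proof. by case=> h0 h; split=> [|x]; rewrite /= /update reg_eqE. Qed.

Lemma env_ok_var n rho s x v :
  env_ok n rho s -> env_ok n (update rho x v) (set_reg s (var_reg x) v).
Proof.
by case=> h0 h; split=> [|y]; rewrite /= /update reg_eqE //; case: ifP.
Qed.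

Lemma env_ok_ext n rho rho' s :
  rho =1 rho' -> env_ok n rho s -> env_ok n rho' s.
Proof. by move=> e [h0 h]; split=> // x; rewrite -e. Qed.

Section ForLoop.

Variables (Inv : nat -> ram_state -> Prop) (n x d c : nat) (P : ram_prog).
Variable rho : nat -> nat.

Hypothesis Inv_keeps : forall i s1 s2,
  Inv i s1 -> mem s2 = mem s1 -> keeps d s1 s2 -> Inv i s2.
Hypothesis Inv_body : forall i s1, i < n -> env_ok n (update rho x i) s1 ->
  Inv i s1 -> exists s2, [/\ exec P s1 c s2, env_ok n (update rho x i) s2,
    reg s2 (tmp_reg d) = reg s1 (tmp_reg d) & Inv i.+1 s2].

(** Induction on the number [r] of remaining rounds, held by [tmp_reg d.+1] at every test. The body
    may overwrite this register, which is recomputed after it. *)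
Lemma exec_for_while r i s : i + r = n -> env_ok n (update rho x i) s ->
  reg s (tmp_reg d.+1) = r -> Inv i s ->
  exists s', [/\ exec (While (tmp_reg d.+1)
         (Seq P
         (Seq (Const (tmp_reg d.+1) 1)
         (Seq (Add (var_reg x) (var_reg x) (tmp_reg d.+1))
              (Sub (tmp_reg d.+1) 0 (var_reg x)))))) s (r * (c + 4) + 1) s',
    env_ok n (update rho x n) s',
    reg s' (tmp_reg d) = reg s (tmp_reg d) & Inv n s'].
Proof.
elim: r i s => [|r IHr] i s hi hs hr hI.
  exists s; rewrite addn0 in hi; rewrite -hi in hs *.
  by split=> //; apply: exec_While_z.
have lt_in : i < n by lia.
have [s2 [ex2 env2 keep2 I2]] := Inv_body lt_in hs hI.
set t := tmp_reg d.+1.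
pose s3 := set_reg s2 t 1.
pose s4 := set_reg s3 (var_reg x) (reg s3 (var_reg x) + reg s3 t).
pose s5 := set_reg s4 t (reg s4 0 - reg s4 (var_reg x)).
have xv : reg s3 (var_reg x) + reg s3 t = i.+1.
  by rewrite /s3 /t /= /update !reg_eqE (proj2 env2) /update eqxx addn1.
have env5 : env_ok n (update rho x i.+1) s5.
  apply: env_ok_tmp; rewrite /s4 xv.
  apply: (@env_ok_ext _ (update (update rho x i) x i.+1)).
    by move=> y; rewrite /update; case: (y == x).
  by apply/env_ok_var/env_ok_tmp.
have keep5 : keeps d.+1 s2 s5.
  apply: (keeps_trans (keeps_tmp s2 1 (leqnn _))).
  by apply: (keeps_trans (@keeps_var _ x s3 _)); apply: keeps_tmp.
have r5 : reg s5 t = r.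
  have -> : reg s5 t = reg s4 0 - reg s4 (var_reg x).
    by rewrite /s5 /= /update eqxx.
  have -> : reg s4 0 = n by exact: (proj1 env5).
  have -> : reg s4 (var_reg x) = i.+1 by rewrite -xv /s4 /= /update eqxx.
  by lia.
have I5 : Inv i.+1 s5.
  by apply: Inv_keeps I2 _ _ => //; apply: keepsW keep5.
have [s' [ex' env' keep' I']] := IHr i.+1 s5 (ltac:(lia)) env5 r5 I5.
exists s'; split=> //.
- have -> : r.+1 * (c + 4) + 1 = (c + (1 + (1 + 1)) + (r * (c + 4) + 1)).+1
    by lia.
  apply: exec_While_nz ex'; first by rewrite hr.
  apply: exec_Seq ex2 _; apply: exec_Seq (exec_Const _ _ _) _.
  exact: exec_Seq (exec_Add _ _ _ _) (exec_Sub _ _ _ _).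
- by rewrite keep' keep5 // keep2.
Qed.

Lemma exec_for s : env_ok n rho s -> Inv 0 s ->
  exists s', [/\ exec (for_prog x d P) s (for_cost n c) s', env_ok n rho s'
    & Inv n s'].
Proof.
move=> hs hI.
pose s1 := set_reg s (tmp_reg d) 0.
pose s2 := set_reg s1 (tmp_reg d) (reg s1 (tmp_reg d) + reg s1 (var_reg x)).
pose s3 := set_reg s2 (var_reg x) 0.
pose s4 := set_reg s3 (tmp_reg d.+1) (reg s3 0 - reg s3 (var_reg x)).
have keep4 : keeps d s s4.
  apply: (keeps_trans (keeps_tmp s 0 (leqnn d))).
  apply: (keeps_trans (keeps_tmp s1 _ (leqnn d))).
  apply: (keeps_trans (@keeps_var _ x s2 0)).
  exact: keeps_tmp.
have env3 : env_ok n (update rho x 0) s3.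
  by apply/env_ok_var/env_ok_tmp/env_ok_tmp.
have env4 : env_ok n (update rho x 0) s4 by apply: env_ok_tmp.
have r4 : reg s4 (tmp_reg d.+1) = n.
  have -> : reg s4 (tmp_reg d.+1) = reg s3 0 - reg s3 (var_reg x).
    by rewrite /s4 /= /update eqxx.
  by rewrite (proj1 env3) (proj2 env3) /update eqxx subn0.
have I4 : Inv 0 s4 by apply: Inv_keeps hI _ keep4.
have [s5 [ex5 env5 keep5 I5]] := exec_for_while (add0n n) env4 r4 I4.
pose s6 := set_reg s5 (var_reg x) 0.
pose s7 := set_reg s6 (var_reg x) (reg s6 (var_reg x) + reg s6 (tmp_reg d)).
(* The old value of the loop variable was saved in [tmp_reg d], which every round preserves. *)
have v7 : reg s6 (var_reg x) + reg s6 (tmp_reg d) = rho x.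
  rewrite /s6 /= /update !reg_eqE keep5 /s4 /s3 /s2 /= /update !reg_eqE.
  by rewrite (ltn_eqF (ltnSn d)) (proj2 hs).
have keep7 : keeps d s5 s7.
  apply: (keeps_trans (@keeps_var _ x s5 0)); exact: keeps_var.
exists s7; split.
- have -> : for_cost n c = 1 + (1 + (1 + (1 + (n * (c + 4) + 1 + (1 + 1))))).
    by rewrite /for_cost; lia.
  apply: exec_Seq (exec_Const _ _ _) _; apply: exec_Seq (exec_Add _ _ _ _) _.
  apply: exec_Seq (exec_Const _ _ _) _; apply: exec_Seq (exec_Sub _ _ _ _) _.
  apply: exec_Seq ex5 _.
  exact: exec_Seq (exec_Const _ _ _) (exec_Add _ _ _ _).
- rewrite /s7 v7.
  apply: (@env_ok_ext _ (update (update (update rho x n) x 0) x (rho x))).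
    by move=> y; rewrite /update; case: eqP => [->|].
  by apply/env_ok_var/env_ok_var.
- by apply: Inv_keeps I5 _ keep7.
Qed.

End ForLoop.

(** The step count is exact whatever the memory contains. As the memory does not change, all
    subexpressions are evaluated in the same one. *)
Lemma exec_compile_expr n rho e d s : env_ok n rho s ->
  exists s', [/\ exec (compile_expr d e) s (cost_expr n e) s',
    env_ok n rho s' /\ keeps d s s', mem s' = mem s
    & reg s' (tmp_reg d) = eval n (mem s) rho e].
Proof.
elim: e rho d s =>
  [|c|x|e IHe|e1 IH1 e2 IH2|e1 IH1 e2 IH2|x e IHe] rho d s hs /=.
- eexists; split; first exact: exec_Seq (exec_Const _ _ _) (exec_Add _ _ _ _).
  + split; first by do 2!apply: env_ok_tmp.
    by apply: (keeps_trans (keeps_tmp _ _ (leqnn d))); apply: keeps_tmp.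
  + by [].
  + by rewrite /= /update !reg_eqE (proj1 hs).
- eexists; split; first exact: exec_Const.
  + by split; [apply: env_ok_tmp | apply: keeps_tmp].
  + by [].
  + by rewrite /= /update !reg_eqE.
- eexists; split; first exact: exec_Seq (exec_Const _ _ _) (exec_Add _ _ _ _).
  + split; first by do 2!apply: env_ok_tmp.
    by apply: (keeps_trans (keeps_tmp _ _ (leqnn d))); apply: keeps_tmp.
  + by [].
  + by rewrite /= /update !reg_eqE (proj2 hs).
- have [s1 [ex1 [env1 keep1] mem1 v1]] := IHe rho d s hs.
  eexists; split; first exact: exec_Seq ex1 (exec_Read _ _ _).
  + split; first exact: env_ok_tmp.
    by apply: (keeps_trans keep1); apply: keeps_tmp.
  + by rewrite /= mem1.
  + by rewrite /= /update eqxx v1 mem1.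
- have [s1 [ex1 [env1 keep1] mem1 v1]] := IH1 rho d s hs.
  have [s2 [ex2 [env2 keep2] mem2 v2]] := IH2 rho d.+1 s1 env1.
  eexists; split.
  + exact: exec_Seq ex1 (exec_Seq ex2 (exec_Add _ _ _ _)).
  + split; first exact: env_ok_tmp.
    apply: (keeps_trans keep1); apply: (keeps_trans (keepsW (leqnSn d) keep2)).
    exact: keeps_tmp.
  + by rewrite /= mem2.
  + by rewrite /= /update eqxx v2 keep2 // v1 mem1.
- have [s1 [ex1 [env1 keep1] mem1 v1]] := IH1 rho d s hs.
  have [s2 [ex2 [env2 keep2] mem2 v2]] := IH2 rho d.+1 s1 env1.
  eexists; split.
  + exact: exec_Seq ex1 (exec_Seq ex2 (exec_Sub _ _ _ _)).
  + split; first exact: env_ok_tmp.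
    apply: (keeps_trans keep1); apply: (keeps_trans (keepsW (leqnSn d) keep2)).
    exact: keeps_tmp.
  + by rewrite /= mem2.
  + by rewrite /= /update eqxx v2 keep2 // v1 mem1.
- pose s0 := set_reg s (tmp_reg d) 0.
  (* The accumulator [tmp_reg d] lies below the registers of the loop, which runs at level [d.+1],
     so its bookkeeping preserves the partial sum. *)
  pose Inv i s1 := [/\ mem s1 = mem s, keeps d s0 s1 &
    reg s1 (tmp_reg d) = \sum_(j < i) eval n (mem s) (update rho x j) e].
  have [||||s' [ex' env' [mem' keep0 v']]] := @exec_for Inv n x d.+1
    (cost_expr n e + 1) (Seq (compile_expr d.+3 e)
      (Add (tmp_reg d) (tmp_reg d) (tmp_reg d.+3))) rho _ _ s0.
  + move=> i s1 s2 [hm hk hv] hm2 hk2; split; first by rewrite hm2.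
      by apply: keeps_trans hk _; apply: keepsW hk2.
    by rewrite hk2.
  + move=> i s1 lt_in env1 [mem1 keep1 v1].
    have [s2 [ex2 [env2 keep2] mem2 v2]] := IHe _ d.+3 s1 env1.
    eexists; split; first exact: exec_Seq ex2 (exec_Add _ _ _ _).
    * exact: env_ok_tmp.
    * rewrite /= /update !reg_eqE (gtn_eqF (ltnSn d)); apply: keep2.
      by rewrite !ltnS.
    * split; first by rewrite /= mem2.
        apply: (keeps_trans keep1).
        apply: (keeps_trans (keepsW _ keep2)); first by rewrite !leqW.
        exact: keeps_tmp.
      have lt_d : d < d.+3 by lia.
      by rewrite /= /update eqxx v2 (keep2 d lt_d) v1 big_ord_recr /= mem1.
  + exact: env_ok_tmp.
  + by split=> //; rewrite big_ord0 /= /update eqxx.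
  exists s'; split=> //; first exact: exec_Seq (exec_Const _ _ _) ex'.
  split=> //; apply: keeps_trans keep0; exact: keeps_tmp.
Qed.

Lemma exec_compile n rho c d s : env_ok n rho s ->
  exists s', [/\ exec (compile d c) s (cost n c) s', env_ok n rho s',
    keeps d s s' & mem s' = run n rho c (mem s)].
Proof.
elim: c rho d s => [a e|c1 IH1 c2 IH2|x c IHc] rho d s hs /=.
- have [s1 [ex1 [env1 keep1] mem1 v1]] := exec_compile_expr a d hs.
  have [s2 [ex2 [env2 keep2] mem2 v2]] := exec_compile_expr e d.+1 env1.
  eexists; split.
  + exact: exec_Seq ex1 (exec_Seq ex2 (exec_Write _ _ _)).
  + exact: env2.
  + exact: (keeps_trans keep1 (keepsW (leqnSn d) keep2)).
  + by rewrite /= v2 keep2 // v1 mem2 mem1.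
- have [s1 [ex1 env1 keep1 mem1]] := IH1 rho d s hs.
  have [s2 [ex2 env2 keep2 mem2]] := IH2 rho d s1 env1.
  exists s2; split=> //; first exact: exec_Seq ex1 ex2.
    exact: keeps_trans keep1 keep2.
  by rewrite mem2 mem1.
- pose Inv i s1 := keeps d s s1 /\
    mem s1 = iteri i (fun i => run n (update rho x i) c) (mem s).
  have [||||s' [ex' env' [keep' mem']]] := @exec_for Inv n x d
    (cost n c) (compile d.+2 c) rho _ _ s => //.
  + move=> i s1 s2 [hk hm] hm2 hk2; split; last by rewrite hm2.
    exact: keeps_trans hk hk2.
  + move=> i s1 lt_in env1 [keep1 mem1].
    have [s2 [ex2 env2 keep2 mem2]] := IHc _ d.+2 s1 env1.
    exists s2; split=> //; first by apply: keep2; rewrite ltnW.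
    split; last by rewrite mem2 mem1.
    by apply: keeps_trans keep1 _; apply: keepsW keep2; rewrite leqW.
  by exists s'; split.
Qed.

(** * Polynomial bounds on the cost *)

(** With the positive base [n.+1], raising the exponent never lowers the bound, even at [n = 0]. *)
Definition poly_bounded (f : nat -> nat) : Prop :=
  exists c d, forall n, f n <= c * n.+1 ^ d.

Lemma poly_bounded_cst c : poly_bounded (fun=> c).
Proof. by exists c, 0 => n; rewrite expn0 muln1. Qed.

Lemma poly_boundedD f g :
  poly_bounded f -> poly_bounded g -> poly_bounded (fun n => f n + g n).
Proof.
move=> [c [d hf]] [c' [d' hg]]; exists (c + c'), (d + d') => n.
rewrite mulnDl leq_add //.
  by apply: leq_trans (hf n) _; rewrite leq_mul2l leq_pexp2l ?leq_addr ?orbT.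
by apply: leq_trans (hg n) _; rewrite leq_mul2l leq_pexp2l ?leq_addl ?orbT.
Qed.

Lemma poly_boundedM f : poly_bounded f -> poly_bounded (fun n => n * f n).
Proof.
move=> [c [d hf]]; exists c, d.+1 => n.
by rewrite expnS mulnCA leq_mul.
Qed.

Lemma poly_bounded_for f :
  poly_bounded f -> poly_bounded (fun n => for_cost n (f n)).
Proof.
move=> hf; apply: poly_boundedD (poly_bounded_cst 7).
exact/poly_boundedM/(poly_boundedD hf)/poly_bounded_cst.
Qed.

Lemma poly_bounded_cost_expr e : poly_bounded (cost_expr^~ e).
Proof.
elim: e => [|c|x|e IHe|e1 IH1 e2 IH2|e1 IH1 e2 IH2|x e IHe] /=;
  try exact: poly_bounded_cst.
- exact/(poly_boundedD IHe)/poly_bounded_cst.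
- exact/(poly_boundedD IH1)/(poly_boundedD IH2)/poly_bounded_cst.
- exact/(poly_boundedD IH1)/(poly_boundedD IH2)/poly_bounded_cst.
- apply: poly_boundedD (poly_bounded_cst 1) _.
  exact/poly_bounded_for/(poly_boundedD IHe)/poly_bounded_cst.
Qed.

Lemma poly_bounded_cost c : poly_bounded (cost^~ c).
Proof.
elim: c => [a e|c1 IH1 c2 IH2|x c IHc] /=.
- apply: poly_boundedD (poly_bounded_cost_expr a) _.
  exact: poly_boundedD (poly_bounded_cost_expr e) (poly_bounded_cst 1).
- exact: poly_boundedD IH1 IH2.
- exact: poly_bounded_for.
Qed.

(** For positive [n], the estimate [n.+1 <= 2 * n] costs a factor [2 ^ d]; the additive constant
    handles [n = 0]. *)
Lemma poly_bounded_monomial f :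
  poly_bounded f -> exists c d, forall n, f n <= c * n ^ d + c.
Proof.
move=> [c [d hf]]; exists (c * 2 ^ d), d => n; apply: leq_trans (hf n) _.
case: n => [|n].
  by rewrite exp1n muln1 (leq_trans _ (leq_addl _ _)) ?leq_pmulr ?expn_gt0.
apply: leq_trans (leq_addr _ _); rewrite -mulnA -expnMn leq_mul2l.
by apply/orP; right; case: d {hf} => // d; rewrite leq_exp2r //; lia.
Qed.

Lemma poly_time_program (c : cmd) (e : expr) :
  exists (P : ram_prog) (a d : nat), forall T : seq nat,
  exists t s, [/\ exec P (ram_input T) t s, t <= a * size T ^ d + a,
    mem s = run (size T) (fun=> 0) c (nth 0 T)
    & reg s 0 = eval (size T) (mem s) (fun=> 0) e].
Proof.
have [a [d had]] : exists a d, forall n,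
    cost n c + (cost_expr n e + (1 + 1)) <= a * n ^ d + a.
  apply/poly_bounded_monomial/(poly_boundedD (poly_bounded_cost c)).
  exact: poly_boundedD (poly_bounded_cost_expr e) (poly_bounded_cst _).
(* Register 0 is where [Size] is read, so the result replaces it only at the very end. *)
exists (Seq (compile 0 c) (Seq (compile_expr 0 e)
  (Seq (Const (var_reg 0) 0) (Add 0 (tmp_reg 0) (var_reg 0))))), a, d => T.
have env0 : env_ok (size T) (fun=> 0) (ram_input T).
  by split=> [|x]; rewrite /= /update.
have [s1 [ex1 env1 _ mem1]] := exec_compile c 0 env0.
have [s2 [ex2 [env2 _] mem2 v2]] := exec_compile_expr e 0 env1.
exists (cost (size T) c + (cost_expr (size T) e + (1 + 1))); eexists; split.
- apply: exec_Seq ex1 (exec_Seq ex2 _).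
  exact: exec_Seq (exec_Const _ _ _) (exec_Add _ _ _ _).
- exact: had.
- by rewrite /= mem2 mem1.
- by rewrite /= /update /= addn0 v2 mem2.
Qed.

(** * Harmonic numbers *)

Section Harmonic.

Import Order.TTheory GRing.Theory Num.Theory.
Local Open Scope ring_scope.

Lemma harmonic_numberS (R : fieldType) p :
  harmonic_number R p.+1 = harmonic_number R p + p.+1%:R^-1.
Proof. by rewrite /harmonic_number big_nat_recr. Qed.

Lemma le_harmonic_number (R : numFieldType) p q : (p <= q)%N ->
  harmonic_number R p <= harmonic_number R q.
Proof.
move=> /subnK <-; elim: (q - p)%N => // d IHd.
by rewrite addSn harmonic_numberS (le_trans IHd) // lerDl invr_ge0.
Qed.

Lemma harmonic_number_ge0 (R : numFieldType) p : 0 <= harmonic_number R p.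
Proof.
rewrite (le_trans _ (le_harmonic_number R (leq0n p))) //.
by rewrite /harmonic_number big_geq.
Qed.

(** The difference consists of [q - p] terms [1/i] with [i <= q <= c], each at least [1/c]. *)
Lemma harmonic_numberB_ge (R : numFieldType) p q c :
  (p <= q)%N -> (q <= c)%N ->
  (q - p)%:R / c%:R <= harmonic_number R q - harmonic_number R p.
Proof.
move=> /subnK <-; elim: (q - p)%N => [|d IHd] hc.
  by rewrite add0n subnn mul0r subrr.
rewrite addSn harmonic_numberS -addSn addnK -natr1 mulrDl mul1r addrAC lerD //.
  by rewrite -{1}(addnK p d) IHd // (leq_trans _ hc) // addSn.
rewrite lef_pV2 ?posrE ?ltr0n ?ler_nat //.
by apply: leq_trans hc; rewrite addSn.
Qed.

(** The induction step is [ln (1 - x) <= - x] at [x = 1/(m+2)]. *)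
Lemma harmonic_number_le_ln (R : realType) m :
  harmonic_number R m.+1 <= ln (m.+1%:R) + 1.
Proof.
elim: m => [|m IHm].
  by rewrite harmonic_numberS /harmonic_number big_geq // add0r invr1 ln1 add0r.
rewrite harmonic_numberS.
have h : ln (m.+1%:R / m.+2%:R : R) <= - m.+2%:R^-1.
  rewrite (_ : m.+1%:R / m.+2%:R = 1 + - m.+2%:R^-1); last first.
    by rewrite -[X in X / _](addrK 1) natr1 mulrBl divff ?pnatr_eq0 // mul1r.
  apply: le_ln1Dx; rewrite ltrN2 invf_lt1 ?ltr0n // ltr1n //.
move: h; rewrite ln_div ?posrE ?ltr0n //.
have aux (a b v x : R) : x <= a + 1 -> a - b <= - v -> x + v <= b + 1 by lra.
exact: aux.
Qed.

(** The logarithmic term equals [ln ((n+1)^2 / 2)], and [n(n+1)/2 <= (n+1)^2 / 2]. *)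
Lemma harmonic_number_triangular_le (R : realType) (n : nat) :
  harmonic_number R ((n * (n + 1)) %/ 2)%N
    <= 2 * ln ((n + 1)%:R / Num.sqrt 2) + 1.
Proof.
have n1 : 0 < (n + 1)%:R :> R by rewrite ltr0n addn1.
have s2 : 0 < Num.sqrt 2 :> R by rewrite sqrtr_gt0.
have -> : 2 * ln ((n + 1)%:R / Num.sqrt 2) = ln ((n + 1)%:R ^+ 2 / 2 : R).
  rewrite -[in RHS](sqr_sqrtr (ler0n R 2)) -exprVn -exprMn lnXn ?divr_gt0 //.
  by rewrite mulr_natl.
(* At [n = 0] the harmonic sum is empty and the claim reduces to [ln 2 <= 1]. *)
case: (posnP n) => [->|n0].
  rewrite /harmonic_number big_geq // expr1n mul1r lnV ?posrE //.
  by have := @le_ln1Dx R 1; rewrite (_ : 1 + 1 = 2) //; lra.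
have m0 : (0 < (n * (n + 1)) %/ 2)%N by rewrite divn_gt0 //; nia.
rewrite -(prednK m0); apply: le_trans (harmonic_number_le_ln _ _) _.
rewrite (prednK m0) lerD2r ler_ln ?posrE ?ltr0n //; last first.
  by rewrite divr_gt0 ?exprn_gt0.
rewrite ler_pdivlMr // -natrM -natrX ler_nat.
by apply: leq_trans (leq_trunc_div _ _) _; nia.
Qed.

End Harmonic.

(** * Greedy set cover *)

Section GreedyCover.

Variables (R : numFieldType) (X U : finType) (S : X -> {set U}).

Definition covered (G : {set X}) : {set U} := \bigcup_(p in G) S p.

Definition gain (G : {set X}) (p : X) : nat := #|S p :\: covered G|.

Definition greedy_choice (G : {set X}) (p : X) : bool :=
  (0 < gain G p) && [forall q, gain G q <= gain G p].

Import Order.TTheory GRing.Theory Num.Theory.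
Local Open Scope ring_scope.

Definition potential (C G : {set X}) : R :=
  \sum_(q in C) (harmonic_number R #|S q| - harmonic_number R (gain G q)).

Lemma coveredU1 G p : covered (p |: G) = S p :|: covered G.
Proof. by rewrite /covered bigcup_setU big_set1. Qed.

Lemma coveredS (G G' : {set X}) : G \subset G' -> covered G \subset covered G'.
Proof.
by move=> sG; apply/bigcupsP => p pG; apply/bigcup_sup/(subsetP sG).
Qed.

Lemma potential0 C : potential C set0 = 0.
Proof.
by apply: big1 => q _; rewrite /gain /covered big_set0 setD0 subrr.
Qed.

Lemma gain_eq0 G p : (gain G p == 0%N) = (S p \subset covered G).
Proof. by rewrite /gain cards_eq0 setD_eq0. Qed.

Lemma greedy_choice_exists G : ~~ [forall p, S p \subset covered G] ->
  exists p, greedy_choice G p.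
Proof.
move=> /forallPn[p0 hp0].
case: (@arg_maxnP _ p0 xpredT (gain G) isT) => p _ hp; exists p.
apply/andP; split; last by apply/forallP => q; apply: hp.
by apply: leq_trans (hp p0 isT); rewrite lt0n gain_eq0.
Qed.

(* Each newly covered element lies in some [S q] with [q] in [C], and the
   [gain G q - gain (p |: G) q] elements that [S q] loses contribute at least
   [1 / gain G p] each to the growth of the potential, as [p] is greedy. *)
Lemma potential_greedy C G p : (forall q, S q \subset covered C) ->
  greedy_choice G p ->
  potential C G + 1 <= potential C (p |: G).
Proof.
move=> hC /andP[c0 /forallP hmax]; set c := gain G p in c0 hmax.
rewrite addrC -lerBrDr -sumrB.
have c0R : 0 < c%:R :> R by rewrite ltr0n.
have step q : (#|S q :&: (S p :\: covered G)|)%:R / c%:R <=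
    harmonic_number R #|S q| - harmonic_number R (gain (p |: G) q) -
    (harmonic_number R #|S q| - harmonic_number R (gain G q)).
  have -> (x y z : R) : x - y - (x - z) = z - y by ring.
  (* The uncovered elements of [S q] split into those that [p] covers and those still uncovered. *)
  have e : (gain G q = #|S q :&: (S p :\: covered G)| + gain (p |: G) q)%N.
    rewrite /gain coveredU1 -(cardsID (S p) (S q :\: covered G)).
    congr addn; apply: eq_card => u; rewrite !inE.
      by rewrite -andbA andbCA.
    by rewrite negb_or -andbA.
  rewrite -[X in X%:R / _](addnK (gain (p |: G) q)) -e.
  by apply: harmonic_numberB_ge; rewrite // e leq_addl.
apply: le_trans (ler_sum _ (fun q _ => step q)).
rewrite -mulr_suml -natr_sum ler_pdivlMr // mul1r ler_nat /c /gain.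
have /setIidPr eqSp : S p :\: covered G \subset covered C.
  exact: subset_trans (subsetDl _ _) (hC p).
(* Distributing the intersection over the union indexed by [C] leaves a union bound on
   cardinalities. *)
rewrite -{1}eqSp {1}/covered big_distrl /=.
apply: (big_ind2 (fun (A : {set U}) k => #|A| <= k)%N) => [|A k B l hA hB|//].
  by rewrite cards0.
by rewrite (leq_trans _ (leq_add hA hB)) // cardsU leq_subr.
Qed.

Lemma potential_le C G M : (forall q, #|S q| <= M)%N ->
  potential C G <= harmonic_number R M * #|C|%:R.
Proof.
move=> hM; rewrite mulr_natr -sumr_const; apply: ler_sum => q _.
rewrite lerBlDr (le_trans (le_harmonic_number R (hM q))) // lerDl.
exact: harmonic_number_ge0.
Qed.

End GreedyCover.

(** * Attractors as set covers *)

Lemma size_substr (T : seq nat) (i j : 'I_(size T)) :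
  size (substr T i j) = j.+1 - i.
Proof.
rewrite /substr size_take size_drop; have := ltn_ord j => hj; case: ltnP; lia.
Qed.

Lemma nth_substr (T : seq nat) (i j x : nat) :
  x < j.+1 - i -> nth 0 (substr T i j) x = nth 0 T (i + x).
Proof. by move=> hx; rewrite /substr nth_take // nth_drop. Qed.

(** Since [i <= j], the common length is positive, so neither subtraction is truncated. *)
Lemma window_eq_len (a b i j k : nat) :
  b.+1 - a = j.+1 - i -> i <= j < i + k -> a <= b < a + k.
Proof. lia. Qed.

Section Attractor.

Variables (T : seq nat) (k : nat).
Notation n := (size T).

(** This is the form that a program can test: lengths, then letters read from a memory that agrees
    with [T] on the input cells only. *)
Lemma substr_eq (m : nat -> nat) (i j i' j' : 'I_n) :
  (forall a, a < n -> m a = nth 0 T a) ->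
  (substr T i' j' == substr T i j) = (j'.+1 - i' == j.+1 - i) &&
    [forall x : 'I_n, (x < j.+1 - i) ==> (m (i' + x) == m (i + x))].
Proof.
move=> hm; apply/eqP/andP => [e|[/eqP el /forallP ex]].
  have el : j'.+1 - i' = j.+1 - i by rewrite -!size_substr e.
  split; first exact/eqP.
  apply/forallP => x; apply/implyP => hx; have := ltn_ord j; have := ltn_ord j'.
  move=> hj' hj; rewrite hm; last by lia.
  rewrite hm; last by lia.
  by rewrite -(@nth_substr T i' j') ?el // e nth_substr.
apply: (@eq_from_nth _ 0); first by rewrite !size_substr.
move=> x; rewrite size_substr => hx.
have := ltn_ord j; have := ltn_ord j' => hj' hj.
have xn : x < n by lia.
have /implyP/(_ _)/eqP := ex (Ordinal xn); rewrite /= -el => /(_ hx).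
rewrite hm; last by lia.
rewrite hm; last by lia.
by rewrite !nth_substr // -el.
Qed.

Definition captures (p : 'I_n) (u : 'I_n * 'I_n) : bool :=
  [exists i' : 'I_n, exists j' : 'I_n,
    (substr T i' j' == substr T u.1 u.2) && (i' <= p <= j')].

Definition leftmost (u : 'I_n * 'I_n) : bool :=
  [forall i' : 'I_n, forall j' : 'I_n,
    (substr T i' j' == substr T u.1 u.2) ==> (u.1 <= i')].

(* The distinct substrings of length at most [k] are represented by their
   leftmost occurrences. *)
Definition captured_set (p : 'I_n) : {set 'I_n * 'I_n} :=
  [set u | leftmost u && (u.1 <= u.2 < u.1 + k) & captures p u].

(** Every substring of length at most [k] has a leftmost occurrence, which belongs to the set of its
    own starting position; so covering all the sets amounts to capturing all these substrings. *)
Lemma attractor_cover (G : {set 'I_n}) :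
  attractor k G = [forall p, captured_set p \subset covered captured_set G].
Proof.
apply/idP/idP => [/forallP aG|/forallP cG].
  apply/forallP => p; apply/subsetP => u; rewrite inE => /andP[hu _].
  have /andP[_ uk] := hu.
  have /forallP/(_ u.2)/implyP/(_ uk) := aG u.1.
  move=> /existsP[i' /existsP[j' /andP[e /existsP[q /andP[qG hq]]]]].
  apply/bigcupP; exists q => //; rewrite inE hu.
  by apply/existsP; exists i'; apply/existsP; exists j'; rewrite e.
apply/forallP => i; apply/forallP => j; apply/implyP => ijk.
pose P (u : 'I_n * 'I_n) := substr T u.1 u.2 == substr T i j.
have P0 : P (i, j) by rewrite /P.
case: (@arg_minnP _ (i, j) P (fun u => u.1) P0) => u /eqP eu umin.
have el : u.2.+1 - u.1 = j.+1 - i by rewrite -!size_substr eu.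
have uS : u \in captured_set u.1.
  rewrite inE; apply/andP; split; first (apply/andP; split).
  - apply/forallP => i'; apply/forallP => j'; apply/implyP; rewrite eu => e.
    exact: (umin (i', j')).
  - exact: window_eq_len el ijk.
  - apply/existsP; exists u.1; apply/existsP; exists u.2.
    by rewrite eqxx leqnn /=; have /andP[] := window_eq_len el ijk.
have /subsetP/(_ u uS)/bigcupP[p pG] := cG u.1.
rewrite inE => /andP[_ /existsP[i' /existsP[j' /andP[/eqP e hp]]]].
apply/existsP; exists i'; apply/existsP; exists j'.
by rewrite e eu eqxx /=; apply/existsP; exists p; rewrite pG.
Qed.

Lemma attractor_setT : attractor k [set: 'I_n].
Proof.
apply/forallP => i; apply/forallP => j; apply/implyP => /andP[ij _].
apply/existsP; exists i; apply/existsP; exists j; rewrite eqxx /=.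
by apply/existsP; exists i; rewrite inE leqnn.
Qed.

Lemma sumn_triangular : sumn [seq b.+1 | b <- iota 0 k] = (k * (k + 1)) %/ 2.
Proof.
suff <- : sumn [seq b.+1 | b <- iota 0 k] * 2 = k * (k + 1) by rewrite mulnK.
elim: k => // l IHl.
rewrite -addn1 iotaD map_cat sumn_cat mulnDl IHl /=; lia.
Qed.

(* An occurrence [i'..j'] through [p] of length at most [k] is determined by
   [(p - i', j' - i')], and [p - i' <= j' - i' < k]. *)
Lemma card_captured_set (p : 'I_n) :
  #|captured_set p| <= (k * (k + 1)) %/ 2.
Proof.
pose occ (u v : 'I_n * 'I_n) :=
  (substr T v.1 v.2 == substr T u.1 u.2) && (v.1 <= p <= v.2).
(* The default [(0, 0)] is never reached on [captured_set p], whose elements all have an occurrence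
   through [p]. *)
pose g u : nat * nat :=
  if [pick v | occ u v] is Some v then (v.2 - v.1, p - v.1) else (0, 0).
have gP u : u \in captured_set p ->
    exists2 v, occ u v & g u = (v.2 - v.1, p - v.1).
  rewrite inE => /andP[_ /existsP[i' /existsP[j' h]]]; rewrite /g.
  case: pickP => [v hv|/(_ (i', j'))]; first by exists v.
  by rewrite /occ h.
have gI : {in captured_set p &, injective g}.
  move=> u1 u2 h1 h2; have [v1 /andP[/eqP e1 o1] ->] := gP _ h1.
  have [v2 /andP[/eqP e2 o2] ->] := gP _ h2 => -[ea eb].
  have f1 : v1.1 = v2.1 by apply: val_inj => /=; lia.
  have f2 : v1.2 = v2.2.
    by apply: val_inj => /=; move: (congr1 val f1) => /=; lia.
  move: h1 h2; rewrite !inE.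
  move=> /andP[/andP[l1 k1] _] /andP[/andP[l2 k2] _].
  have e : substr T u1.1 u1.2 = substr T u2.1 u2.2 by rewrite -e1 -e2 f1 f2.
  have el : u1.2.+1 - u1.1 = u2.2.+1 - u2.1 by rewrite -!size_substr e.
  (* Two leftmost occurrences of the same substring start at the same place, each being at most the
     other. *)
  have /forallP/(_ u2.2)/implyP := forallP l1 u2.1.
  have /forallP/(_ u1.2)/implyP := forallP l2 u1.1.
  rewrite e eqxx => /(_ isT) le21 /(_ isT) le12.
  case: u1 u2 {e1 e2 l1 l2 e} k1 k2 el le12 le21 => a1 b1 [a2 b2] /=.
  by move=> *; congr pair; apply: val_inj => /=; lia.
pose L := [seq (b, a) | b <- iota 0 k, a <- iota 0 b.+1].
have <- : size L = (k * (k + 1)) %/ 2.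
  rewrite size_allpairs_dep -sumn_triangular; congr sumn.
  by apply: eq_map => b; rewrite size_iota.
rewrite cardE -(size_map g); apply: uniq_leq_size.
  rewrite map_inj_in_uniq ?enum_uniq // => u v; rewrite !mem_enum.
  exact: gI.
move=> y /mapP[u]; rewrite mem_enum => uS ->.
have [v /andP[/eqP e o] ->] := gP _ uS.
have el : v.2.+1 - v.1 = u.2.+1 - u.1 by rewrite -!size_substr e.
move: uS; rewrite inE => /andP[/andP[_ uk] _].
have {}uk := window_eq_len el uk.
apply/allpairsPdep; exists (v.2 - v.1), (p - v.1).
by rewrite !mem_iota; split=> //; lia.
Qed.

End Attractor.

(** * The greedy program *)

(** The connectives are meant for operands with values 0 and 1; [not_expr] also sends every positive
    number to 0. *)
Definition not_expr (e : expr) : expr := Minus (Lit 1) e.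
Definition and_expr (a b : expr) : expr := Minus (Plus a b) (Lit 1).
Definition or_expr (a b : expr) : expr :=
  not_expr (and_expr (not_expr a) (not_expr b)).
Definition imp_expr (a b : expr) : expr := or_expr (not_expr a) b.
Definition le_expr (a b : expr) : expr := not_expr (Minus a b).
Definition lt_expr (a b : expr) : expr := le_expr (Plus a (Lit 1)) b.
Definition eq_expr (a b : expr) : expr :=
  not_expr (Plus (Minus a b) (Minus b a)).
(** The double negation collapses the number of witnesses to 0 or 1. *)
Definition ex_expr (x : nat) (e : expr) : expr := not_expr (not_expr (Sum x e)).
Definition all_expr (x : nat) (e : expr) : expr :=
  not_expr (Sum x (not_expr e)).

(** * Values of the Boolean expressions *)

Section Eval.

Variables (n : nat) (m rho : nat -> nat).
Notation ev := (eval n m rho).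

Lemma eval_not e (b : bool) : ev e = b -> ev (not_expr e) = ~~ b.
Proof. by move=> /= ->; case: b. Qed.

Lemma eval_and e1 e2 (b1 b2 : bool) :
  ev e1 = b1 -> ev e2 = b2 -> ev (and_expr e1 e2) = (b1 && b2).
Proof. by move=> /= -> ->; case: b1 b2 => [] []. Qed.

Lemma eval_or e1 e2 (b1 b2 : bool) :
  ev e1 = b1 -> ev e2 = b2 -> ev (or_expr e1 e2) = (b1 || b2).
Proof. by move=> /= -> ->; case: b1 b2 => [] []. Qed.

Lemma eval_imp e1 e2 (b1 b2 : bool) :
  ev e1 = b1 -> ev e2 = b2 -> ev (imp_expr e1 e2) = (b1 ==> b2).
Proof. by move=> /= -> ->; case: b1 b2 => [] []. Qed.

Lemma eval_le e1 e2 : ev (le_expr e1 e2) = (ev e1 <= ev e2).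
Proof. by rewrite /=; lia. Qed.

Lemma eval_lt e1 e2 : ev (lt_expr e1 e2) = (ev e1 < ev e2).
Proof. by rewrite eval_le /= addn1. Qed.

Lemma eval_eq e1 e2 : ev (eq_expr e1 e2) = (ev e1 == ev e2).
Proof. by rewrite /=; lia. Qed.

Lemma sum_bool_eq0 (P : pred 'I_n) :
  (\sum_(i < n) P i == 0) = [forall i, ~~ P i].
Proof.
rewrite sum_nat_eq0; apply: eq_forallb => i /=; by case: (P i).
Qed.

Lemma eval_ex x e (P : pred 'I_n) :
  (forall i : 'I_n, eval n m (update rho x i) e = P i) ->
  ev (ex_expr x e) = [exists i, P i].
Proof.
move=> /= h; rewrite (eq_bigr (fun i => nat_of_bool (P i))) //.
rewrite -[[exists i, _]]negbK negb_exists -sum_bool_eq0.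
by case: (\sum_(i < n) P i).
Qed.

Lemma eval_all x e (P : pred 'I_n) :
  (forall i : 'I_n, eval n m (update rho x i) e = P i) ->
  ev (all_expr x e) = [forall i, P i].
Proof.
move=> /= h; rewrite (eq_bigr (fun i => nat_of_bool (~~ P i))); last first.
  by move=> i _; rewrite h; case: (P i).
have -> : [forall i, P i] = (\sum_(i < n) ~~ P i == 0).
  rewrite (sum_bool_eq0 [pred i | ~~ P i]); apply: eq_forallb => i.
  by rewrite negbK.
by case: (\sum_(i < n) ~~ P i).
Qed.

End Eval.

(* Variables 0 and 1 hold the element [(i, j)], variables 2 and 3 an occurrence
   [(i', j')], variable 4 an offset, variable 5 a chosen position, variables 6
   and 7 the candidate position and its competitors. *)
Definition len_expr (i j : nat) : expr := Minus (Plus (Var j) (Lit 1)) (Var i).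

Definition same_expr : expr :=
  and_expr (eq_expr (len_expr 2 3) (len_expr 0 1))
    (all_expr 4 (imp_expr (lt_expr (Var 4) (len_expr 0 1))
      (eq_expr (Fetch (Plus (Var 2) (Var 4))) (Fetch (Plus (Var 0) (Var 4)))))).

Definition captures_expr (p : nat) : expr :=
  ex_expr 2 (ex_expr 3 (and_expr same_expr
    (and_expr (le_expr (Var 2) (Var p)) (le_expr (Var p) (Var 3))))).

Definition leftmost_expr : expr :=
  all_expr 2 (all_expr 3 (imp_expr same_expr (le_expr (Var 0) (Var 2)))).

(** The characteristic function of the current solution occupies the [n] cells just after the
    input. *)
Definition flag_expr (p : nat) : expr := Fetch (Plus Size (Var p)).

Definition covered_expr : expr :=
  ex_expr 5 (and_expr (flag_expr 5) (captures_expr 5)).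

Definition new_expr (K : expr) (p : nat) : expr :=
  and_expr
    (and_expr (and_expr leftmost_expr (and_expr (le_expr (Var 0) (Var 1))
        (lt_expr (Var 1) (Plus (Var 0) K))))
      (captures_expr p))
    (not_expr covered_expr).

Definition gain_expr (K : expr) (p : nat) : expr :=
  Sum 0 (Sum 1 (new_expr K p)).

Definition greedy_expr (K : expr) : expr :=
  and_expr (lt_expr (Lit 0) (gain_expr K 6))
    (all_expr 7 (le_expr (gain_expr K 7) (gain_expr K 6))).

(** One pass may add several positions, each a greedy choice for the set current at that moment. The
    disjunction keeps those already chosen. *)
Definition pass_cmd (K : expr) : cmd :=
  For 6 (Store (Plus Size (Var 6)) (or_expr (flag_expr 6) (greedy_expr K))).

(** The solution is written over the input letters; the flags, stored from cell [n] on, survive. *)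
Definition output_cmd : cmd :=
  For 0 (Store (Var 0) (Sum 1 (le_expr
    (Sum 2 (and_expr (le_expr (Var 2) (Var 1)) (flag_expr 2))) (Var 0)))).

Definition attractor_cmd (K : expr) : cmd :=
  Then (For 8 (pass_cmd K)) output_cmd.

(** * Counting and iteration lemmas *)

Lemma card_pairE (X Y : finType) (A : {set X * Y}) :
  #|A| = \sum_i \sum_j ((i, j) \in A).
Proof.
rewrite pair_bigA /= -sum1_card big_mkcond.
by apply: eq_bigr => [[i j]] _ /=; case: ifP.
Qed.

(* The number of [p] with at most [r] elements of [f] up to [p] is the [r]-th
   element of [f]. *)
Lemma nth_filter_iota (f : pred nat) N r : r < count f (iota 0 N) ->
  \sum_(p < N) (count f (iota 0 p.+1) <= r) = nth 0 (filter f (iota 0 N)) r.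
Proof.
have mono a b : a <= b -> count f (iota 0 a) <= count f (iota 0 b).
  by move=> /subnKC <-; rewrite iotaD count_cat leq_addr.
elim: N => // N IHN; rewrite big_ord_recr.
have -> : iota 0 N.+1 = iota 0 N ++ [:: N] by rewrite -addn1 iotaD.
rewrite filter_cat !count_cat nth_cat size_filter.
rewrite [count f [:: N]]/= [filter f [:: N]]/= addn0.
rewrite -[X in _ -> X = _]/(\sum_(i < N) (count f (iota 0 i.+1) <= r) +
  (count f (iota 0 N) + f N <= r)).
(* Either the element was found before [N] and the new term is 0, or it is [N] itself and each of
   the [N] earlier terms is 1. *)
case: (ltnP r (count f (iota 0 N))) => [rN _|Nr].
  by rewrite -IHN // leqNgt (leq_trans rN) ?leq_addr //= addn0.
case: (f N); last by rewrite addn0 ltnNge Nr.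
rewrite addn1 ltnS => rN.
have -> : r = count f (iota 0 N) by apply/eqP; rewrite eqn_leq rN.
rewrite ltnn addn0 subnn -[RHS](card_ord N) -sum1_card; apply: eq_bigr => p _.
by rewrite (mono p.+1 N (ltn_ord p)).
Qed.

Lemma sum_leq_count (f : pred nat) N (p : 'I_N) :
  \sum_(q < N) ((q <= p) && f q) = count f (iota 0 p.+1).
Proof.
rewrite -(big_mkord xpredT (fun q => nat_of_bool ((q <= p) && f q))).
rewrite (@big_cat_nat _ _ _ p.+1) //.
have -> : \sum_(p.+1 <= q < N) nat_of_bool ((q <= p) && f q) = 0.
  by rewrite big_nat big1 // => q /andP[pq _]; rewrite leqNgt pq.
rewrite Monoid.mulm1.
rewrite (@eq_big_nat _ _ _ _ _ _ (fun q => nat_of_bool (f q))); last first.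
  by move=> q /=; rewrite ltnS => ->.
rewrite -sum1_count [RHS]big_mkcond /=; apply: eq_bigr => q _.
by case: (f q).
Qed.

(** Round [i] writes cell [i] only, so cell [a] gets its final value in round [a], computed from the
    memory of that moment. *)
Lemma iteri_update (N a : nat) (g : nat -> (nat -> nat) -> nat)
    (m : nat -> nat) :
  iteri N (fun i m => update m i (g i m)) m a =
  if a < N then g a (iteri a (fun i m => update m i (g i m)) m) else m a.
Proof.
elim: N => // N IHN; rewrite [LHS]/= {1}/update ltnS leq_eqVlt.
by case: eqP => [->|].
Qed.

(** * Correctness of the greedy program *)

Section Correctness.

Variables (T : seq nat) (k : nat) (K : expr).
Notation n := (size T).
Hypothesis eval_K : forall m rho, eval n m rho K = k.

(** Separate from the agreement with [T], because only the flags outlive the output phase. *)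
Definition flags (m : nat -> nat) (G : {set 'I_n}) : Prop :=
  forall p : 'I_n, m (n + p) = (p \in G).

Definition represents (m : nat -> nat) (G : {set 'I_n}) : Prop :=
  (forall a, a < n -> m a = nth 0 T a) /\ flags m G.

Section EvalGreedy.

Variables (m : nat -> nat) (G : {set 'I_n}).
Hypothesis mG : represents m G.

Lemma eval_same (rho : nat -> nat) (i j i' j' : 'I_n) :
  rho 0 = i -> rho 1 = j -> rho 2 = i' -> rho 3 = j' ->
  eval n m rho same_expr = (substr T i' j' == substr T i j).
Proof.
move=> h0 h1 h2 h3; rewrite (substr_eq _ _ _ _ (proj1 mG)).
apply: eval_and; first by rewrite eval_eq /= h0 h1 h2 h3 !addn1.
apply: eval_all => x; apply: eval_imp.
  by rewrite eval_lt /= /update /= h0 h1 addn1.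
by rewrite eval_eq /= /update /= h0 h2.
Qed.

(** The bound on [v] keeps the position variable away from the variables bound inside the
    expression. *)
Lemma eval_captures (rho : nat -> nat) v (p i j : 'I_n) : 4 < v ->
  rho v = p -> rho 0 = i -> rho 1 = j ->
  eval n m rho (captures_expr v) = captures p (i, j).
Proof.
move=> v4 hp h0 h1; apply: eval_ex => i'; apply: eval_ex => j'.
have [v2 v3] : (v == 2) = false /\ (v == 3) = false by lia.
apply: eval_and; first exact: (@eval_same _ i j i' j').
by apply: eval_and; rewrite eval_le /= /update /= ?v2 ?v3 ?hp.
Qed.

Lemma eval_leftmost (rho : nat -> nat) (i j : 'I_n) : rho 0 = i -> rho 1 = j ->
  eval n m rho leftmost_expr = leftmost (i, j).
Proof.
move=> h0 h1; apply: eval_all => i'; apply: eval_all => j'.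
apply: eval_imp; first exact: (@eval_same _ i j i' j').
by rewrite eval_le /= /update /= h0.
Qed.

Lemma eval_flag (rho : nat -> nat) v (p : 'I_n) :
  rho v = p -> eval n m rho (flag_expr v) = (p \in G).
Proof. by move=> /= ->; rewrite (proj2 mG). Qed.

Lemma eval_gain (rho : nat -> nat) v (p : 'I_n) : 5 < v -> rho v = p ->
  eval n m rho (gain_expr K v) = gain (captured_set k) G p.
Proof.
move=> v5 hp; rewrite /gain card_pairE.
transitivity (\sum_(i < n) \sum_(j < n)
  eval n m (update (update rho 0 i) 1 j) (new_expr K v)); first by [].
apply: eq_bigr => i _; apply: eq_bigr => j _.
set r := update _ 1 j.
have r0 : r 0 = i by [].
have r1 : r 1 = j by [].
have rp : r v = p.
  have [v0 v1] : (v == 0) = false /\ (v == 1) = false by lia.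
  by rewrite /r /update v0 v1.
(* The leftmost and length conditions are common to all the sets, so being covered reduces to being
   captured by a member of [G]. *)
have -> : ((i, j) \in captured_set k p :\: covered (captured_set k) G) =
    (leftmost (i, j) && (i <= j < i + k) && captures p (i, j)) &&
    ~~ [exists q, (q \in G) && captures q (i, j)].
  rewrite in_setD andbC inE; case: (boolP (_ && captures p _)) => //=.
  move=> /andP[hu _]; congr (~~ _); apply/bigcupP/existsP => -[q].
    by rewrite inE => qG /andP[_ hq]; exists q; rewrite qG.
  by move=> /andP[qG hq]; exists q; rewrite // inE hu.
apply: eval_and; last first.
  apply/eval_not/eval_ex => q; apply: eval_and; first exact: eval_flag.
  exact: eval_captures.
apply: eval_and; last by apply: eval_captures => //; apply: ltnW.
apply: eval_and; first exact: eval_leftmost.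
apply: eval_and; first by rewrite eval_le.
by rewrite eval_lt [eval _ _ _ (Plus _ _)]/= eval_K.
Qed.

Lemma eval_greedy (rho : nat -> nat) (p : 'I_n) : rho 6 = p ->
  eval n m rho (greedy_expr K) = greedy_choice (captured_set k) G p.
Proof.
move=> hp; apply: eval_and; first by rewrite eval_lt (eval_gain _ hp).
apply: eval_all => q; rewrite eval_le (@eval_gain _ 7 q) //.
by rewrite (@eval_gain _ 6 p).
Qed.

End EvalGreedy.

Definition greedy_step (G : {set 'I_n}) (p : 'I_n) : {set 'I_n} :=
  if greedy_choice (captured_set k) G p then p |: G else G.

Lemma run_step m G (rho : nat -> nat) (p : 'I_n) :
  represents m G -> rho 6 = p ->
  represents (run n rho (Store (Plus Size (Var 6))
      (or_expr (flag_expr 6) (greedy_expr K))) m)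
    (greedy_step G p).
Proof.
move=> mG hp; have [mT mF] := mG.
have hv := eval_or (eval_flag mG hp) (eval_greedy mG hp).
rewrite [run _ _ _ _]/run [eval _ _ _ (Plus _ _)]/eval hp hv.
split=> [a an|q]; rewrite /update.
  by rewrite ltn_eqF ?mT // ltn_addr.
rewrite eqn_add2l val_eqE /greedy_step; case: eqP => [->|/eqP qp].
  by case: ifP; rewrite ?orbF // orbT !inE eqxx.
by rewrite mF; case: ifP; rewrite // !inE (negPf qp).
Qed.

Section Invariant.

Variable good : {set 'I_n} -> Prop.
Hypothesis good0 : good set0.
Hypothesis good_step : forall G p, good G ->
  greedy_choice (captured_set k) G p -> good (p |: G).

(** A pass that changes nothing has rejected every position for the same [G], so no greedy choice
    exists and everything is covered. The abstract [good] separates the program from the analysis of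
    the ratio. *)
Lemma run_pass rho m G : represents m G -> good G ->
  exists G', [/\ represents (run n rho (pass_cmd K) m) G', good G', G \subset G'
    & G' = G -> attractor k G].
Proof.
move=> mG gG.
have loop i : i <= n -> exists G', [/\ represents (iteri i (fun j =>
    run n (update rho 6 j) (Store (Plus Size (Var 6))
      (or_expr (flag_expr 6) (greedy_expr K)))) m) G', good G', G \subset G'
    & G' = G -> forall p : 'I_n, p < i ->
        ~~ greedy_choice (captured_set k) G p].
  elim: i => [_|i IHi lt_in]; first by exists G.
  have [G' [rG' gG' sG' hG']] := IHi (ltnW lt_in).
  pose p := Ordinal lt_in.
  exists (greedy_step G' p); split.
  - by rewrite [iteri _ _ _]/=; apply: run_step.
  - by rewrite /greedy_step; case: ifP => // /good_step; apply.
  - rewrite /greedy_step; case: ifP => // _.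
    exact: subset_trans sG' (subsetUr _ _).
  (* If [p] was added and the result is still [G], then [p] was already in [G'] and its gain was 0,
     a contradiction. *)
  - rewrite /greedy_step; case: ifP => [ch e|/negbT nch e q].
      have pG' : p \in G' by apply: (subsetP sG'); rewrite -e setU11.
      have e' : G' = G by rewrite -e; apply/esym/setUidPr; rewrite sub1set.
      move: ch => /andP[]; rewrite lt0n gain_eq0 => /negP[].
      exact: bigcup_sup.
    rewrite ltnS leq_eqVlt => /orP[/eqP qi|]; last exact: hG'.
    by rewrite (_ : q = p) -?e //; apply: val_inj.
have [G' [rG' gG' sG' hG']] := loop n (leqnn n).
exists G'; split=> // e; rewrite attractor_cover; apply: contraT => nc.
have [p ch] := greedy_choice_exists nc.
by have := hG' e p (ltn_ord p); rewrite ch.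
Qed.

Lemma attractorS (G G' : {set 'I_n}) :
  G \subset G' -> attractor k G -> attractor k G'.
Proof.
rewrite !attractor_cover => sG /forallP h; apply/forallP => p.
exact: subset_trans (h p) (coveredS _ sG).
Qed.

(** Each pass that starts without an attractor adds a position; after [n] passes the set is an
    attractor or contains all positions, which again makes it one. *)
Lemma run_passes rho : exists G,
  [/\ flags (run n rho (For 8 (pass_cmd K)) (nth 0 T)) G, good G
    & attractor k G].
Proof.
have loop i : exists G, [/\ represents (iteri i (fun j =>
    run n (update rho 8 j) (pass_cmd K)) (nth 0 T)) G, good G
    & attractor k G \/ i <= #|G|].
  elim: i => [|i [G [rG gG hG]]].
    exists set0; split=> //; last by right.
    (* Beyond the input the memory is initially 0, which encodes the empty set. *)
    by split=> // p; rewrite in_set0; apply: nth_default (leq_addr _ _).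
  have [G' [rG' gG' sG' hG']] := run_pass (update rho 8 i) rG gG.
  exists G'; split=> //.
  have [aG|naG] := boolP (attractor k G); first by left; apply: attractorS aG.
  right; case: hG naG => [->//|iG naG]; apply: leq_ltn_trans iG _.
  rewrite proper_card // properEneq sG' andbT.
  by apply: contraNneq naG => e; apply: hG'.
have [G [[_ rG] gG hG]] := loop n; exists G; split=> //.
case: hG => // nG; have -> : G = setT; last exact: attractor_setT.
by apply/eqP; rewrite eqEcard subsetT cardsT card_ord.
Qed.

End Invariant.

Lemma run_output (rho m : nat -> nat) (G : {set 'I_n}) : flags m G ->
  flags (run n rho output_cmd m) G /\
  perm_eq (mkseq (run n rho output_cmd m) #|G|) [seq val p | p <- enum G].
Proof.
move=> mG.
pose f a := if insub a is Some p then p \in G else false.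
have fE (p : 'I_n) : f p = (p \in G) by rewrite /f valK.
pose e2 := and_expr (le_expr (Var 2) (Var 1)) (flag_expr 2).
pose e1 := le_expr (Sum 2 e2) (Var 0).
pose e := Sum 1 e1.
pose g i m1 := eval n m1 (update rho 0 i) e.
have flagsI i : i <= n -> flags (iteri i (fun i m => update m i (g i m)) m) G.
  move=> le_in p; rewrite iteri_update ltnNge.
  by rewrite (leq_trans le_in) ?leq_addr // mG.
have -> : run n rho output_cmd m =
    iteri n (fun i m => update m i (g i m)) m by [].
split; first exact: flagsI.
(* Stated for any memory with the right flags, since the cells before [r] have been overwritten by
   then. *)
have gE m1 r : flags m1 G -> r < count f (iota 0 n) ->
    g r m1 = nth 0 (filter f (iota 0 n)) r.
  move=> m1G rn; rewrite -nth_filter_iota //.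
  transitivity (\sum_(p < n) eval n m1 (update (update rho 0 r) 1 p) e1).
    by [].
  apply: eq_bigr => p _; rewrite eval_le; congr (nat_of_bool (_ <= _)).
  transitivity (\sum_(q < n)
    eval n m1 (update (update (update rho 0 r) 1 p) 2 q) e2); first by [].
  transitivity (\sum_(q < n) ((q <= p) && f q)).
    apply: eq_bigr => q _; apply: eval_and; first by rewrite eval_le.
    by rewrite fE; apply: m1G.
  exact: sum_leq_count.
have fG : filter f (iota 0 n) = [seq val p | p <- enum G].
  rewrite -val_enum_ord filter_map; congr map.
  by rewrite {2}/enum_mem -enumT; apply: eq_filter => p /=; rewrite fE.
have cG : count f (iota 0 n) = #|G|.
  by rewrite -size_filter fG size_map cardE.
rewrite -fG; set m' := iteri _ _ _.
suff -> : mkseq m' #|G| = filter f (iota 0 n) by [].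
apply: (@eq_from_nth _ 0); first by rewrite size_mkseq size_filter cG.
move=> r; rewrite size_mkseq => rG; rewrite nth_mkseq // /m' iteri_update.
have rn : r < n by apply: leq_trans rG _; rewrite -[leqRHS]card_ord max_card.
by rewrite rn gE ?cG //; apply: flagsI; apply: ltnW.
Qed.

End Correctness.

(** * The approximation theorem *)

(** Taking [K] as an expression treats a constant [k] and [k = n] uniformly. *)
Lemma attractor_poly_time_approx (R : numFieldType) (K : expr)
    (kf : nat -> nat) :
  (forall n m rho, eval n m rho K = kf n) ->
  poly_time_approx (fun T : seq nat => @attractor nat (kf (size T)) T)
    (fun n => harmonic_number R ((kf n * (kf n + 1)) %/ 2)).
Proof.
move=> hK.
have [P [c [d hP]]] :=
  poly_time_program (attractor_cmd K) (Sum 0 (flag_expr 0)).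
exists P, c, d => T; have [t [s [ex ht hmem hreg]]] := hP T.
set k := kf (size T).
pose S := @captured_set T k.
(* The optimum is unknown to the program, so the potential bound is maintained against every
   attractor [C] at once. *)
pose good (G : {set 'I_(size T)}) := forall C : {set 'I_(size T)},
  attractor k C -> (#|G|%:R <= potential R S C G)%R.
have good0 : good set0 by move=> C _; rewrite potential0 cards0.
have good_step (G : {set 'I_(size T)}) p :
    good G -> greedy_choice S G p -> good (p |: G).
  move=> gG ch C aC.
  have cC q : S q \subset covered S C.
    by move: aC; rewrite attractor_cover => /forallP.
  apply: Order.POrderTheory.le_trans (potential_greedy R cC ch).
  have pG : p \notin G.
    apply/negP => pG; move: ch => /andP[]; rewrite lt0n gain_eq0 => /negP[].
    exact: bigcup_sup.
  by rewrite cardsU1 pG addnC GRing.natrD Num.Theory.lerD2r gG.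
have [G [fG gG aG]] := run_passes (hK (size T)) good0 good_step (fun=> 0).
have [fG' out] := run_output (fun=> 0) fG.
exists t, s, G; split=> //.
(* The output length is the sum of the flags, read after the output phase. *)
- suff size_out : reg s 0 = #|G| by rewrite /ram_output size_out hmem.
  rewrite hreg hmem -sum1_card big_mkcond; apply: eq_bigr => p _.
  by rewrite [LHS]fG'; case: (p \in G).
- move=> C [aC _]; apply: Order.POrderTheory.le_trans (gG C aC) _.
  exact: potential_le (@card_captured_set T k).
Qed.

Theorem theorem4p5 (R : realType) :
  (forall k : nat, 3 <= k ->
     poly_time_approx (fun T : seq nat => @attractor nat k T)
       (fun _ : nat => harmonic_number R ((k * (k + 1)) %/ 2)))
  /\
  poly_time_approx (fun T : seq nat => @string_attractor nat T)
    (fun n : nat => harmonic_number R ((n * (n + 1)) %/ 2))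
  /\
  (forall n : nat,
     (harmonic_number R ((n * (n + 1)) %/ 2)%N
        <= 2 * ln ((n + 1)%:R / Num.sqrt 2) + 1)%R).
Proof.
split=> [k _|].
  exact: (@attractor_poly_time_approx R (Lit k) (fun=> k)).
split; last exact: harmonic_number_triangular_le.
exact: (@attractor_poly_time_approx R Size id).
Qed.
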